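(* Let $G=([n],E)$ be a digraph without loops and parallel arcs, and let $\beta\in(0,1)$ be sufficiently close to $1$ (namely $\beta\in[\alpha^*,1)$). If $(B',L',U')$ is a feasible basis for $\mathcal P_\beta(G')$, then $B'$ is a good augmented tree.
   Context: $G=(V,E)$ is a digraph without loops and parallel arcs on $V=[n]$, $n\geq2$; $N^-(i)=\{j:(j,i)\in E\}$, $N^+(i)=\{j:(i,j)\in E\}$. For $\beta\in(0,1)$, $\mathcal{WH}_\beta(G)$ is the set of all $(x,y)\in\mathbb R^{E}\times\mathbb R^{V\setminus\{1\}}$ with (1) $\sum_{j\in N^+(1)}x_{1j}-\beta\sum_{j\in N^-(1)}x_{j1}=1-\beta^n$; (2) $\sum_{j\in N^+(i)}x_{ij}-\beta\sum_{j\in N^-(i)}x_{ji}=0$ for $i\in V\setminus\{1\}$; (3) $\sum_{j\in N^+(1)}x_{1j}=1$; (4) $\sum_{j\in N^+(i)}x_{ij}-y_i=\beta^{n-1}$ for $i\in V\setminus\{1\}$; (5) $0\leq y_i\leq\beta-\beta^{n-1}$ for $i\in V\setminus\{1\}$; (6) $x_{ij}\geq0$ for $(i,j)\in E$. A basis is a triple $(B,L,U)$ where $B=A\cup Y$, $A\subseteq E$ (basic $x$-variables), $Y\subseteq V\setminus\{1\}$ (basic $y$-variables), $|A|+|Y|=2n$, $L\cup U$ is a partition of $V\setminus(\{1\}\cup Y)$ (parts possibly empty), and the $2n\times2n$ submatrix of the coefficient matrix of (1)–(4) with columns $B$ is invertible. Its basic solution is the unique solution of (1)–(4) with $x_{ij}=0$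 for $(i,j)\in E\setminus A$, $y_i=0$ for $i\in L$, $y_i=\beta-\beta^{n-1}$ for $i\in U$; the basis is feasible if this solution satisfies (5),(6). There is $\alpha^*\in(0,1)$ (depending on $G$) such that the set of feasible bases is the same for all $\beta\in[\alpha^*,1)$; fix such $\alpha^*$. The digraph $G'=(V',E')$ has $V'=\{v_i:i\in V\}\cup\{w_i:i\in V\}$ and $E'=E_1'\cup E_2'$ with $E_1'=\{(w_i,v_j):(i,j)\in E\}$, $E_2'=\{(v_i,w_i):i\in V\setminus\{1\}\}$. $\mathcal P_\beta(G')$ denotes $\mathcal{WH}_\beta(G)$ viewed as a generalized network flow polytope on $G'$: the flow on $(w_i,v_j)$ is $x_{ij}$, the flow on $(v_i,w_i)$ is $y_i$, the arc multipliers are $\mu_e=\beta$ for $e\in E_1'$ and $\mu_e=1$ for $e\in E_2'$. A (feasible) basis $(B',L',U')$ of $\mathcal P_\beta(G')$ is a (feasible) basis $(B,L,U)$ of $\mathcal{WH}_\beta(G)$ under this identification of variables with arcs of $G'$: $B'\subseteq E'$ is the set of arcs of basic variables, $L'$ and $U'$ the sets of arcs of non-basic variables at their lower and upper bounds (all non-basic arcs of $E_1'$ lie in $L'$). $B'$ is identified with the subgraph $(V',B')$ of $G'$. For a (not necessarily directed) cycle $C$ with a given orientation, let $\overline C,\underline C$ be its sets of forward and backward arcs; its cycle multiplier is $\mu(C)=\prod_{e\in\overline C}\mu_e/\prod_{e\in\underline C}\mu_e$, and $C$ is breakeven if $\mu(C)=1$. An augmented tree is a connected graph (ignoring arc directions)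 containing exactly one cycle, called the extra cycle; it is a good augmented tree if its extra cycle is not breakeven. *)

(* Defs.v *)
From mathcomp Require Import all_boot all_order all_algebra.
From mathcomp Require Import reals.

Set Implicit Arguments.
Unset Strict Implicit.
Unset Printing Implicit Defensive.

Import Order.TTheory GRing.Theory Num.Theory.
Local Open Scope ring_scope.

(* Vertex i of [n] is encoded as i - 1 : 'I_n, so that vertex 1 is 0.  A
   digraph without loops and parallel arcs is an irreflexive G : rel 'I_n. *)
Definition nonroot (n : nat) := {i : 'I_n | i != 0%N :> nat}.

Definition darc n (G : rel 'I_n) := {e : 'I_n * 'I_n | G e.1 e.2}.

Definition src n (G : rel 'I_n) (e : darc G) : 'I_n := (val e).1.
Definition dst n (G : rel 'I_n) (e : darc G) : 'I_n := (val e).2.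

(* inl e stands for the variable x_e and inr i for the variable y_i. *)
Definition var n (G : rel 'I_n) := (darc G + nonroot n)%type.

Section Polytope.
Variables (R : realType) (n : nat) (G : rel 'I_n) (beta : R).
Implicit Types (x : darc G -> R) (y : nonroot n -> R).
Implicit Types (B : {set var G}) (L U : {set nonroot n}).

Definition outflow x (i : nat) : R := \sum_(e : darc G | src e == i :> nat) x e.
Definition inflow x (i : nat) : R := \sum_(e : darc G | dst e == i :> nat) x e.

Record WH_equations x y : Prop := WHEquations {
  WH_conservation_root : outflow x 0%N - beta * inflow x 0%N = 1 - beta ^+ n;
  WH_conservation : forall i : nonroot n,
    outflow x (val i) - beta * inflow x (val i) = 0;
  WH_outflow_root : outflow x 0%N = 1;
  WH_outflow : forall i : nonroot n,
    outflow x (val i) - y i = beta ^+ (n - 1)%N }.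

Record WH x y : Prop := WHPoint {
  WH_eqs : WH_equations x y;
  WH_y_bounds : forall i, 0 <= y i <= beta - beta ^+ (n - 1)%N;
  WH_x_ge0 : forall e, 0 <= x e }.

(* The left-hand sides of WH_equations: row inl i is the conservation equation
   of vertex i, and row inr i is its outflow equation. *)
Definition WH_coef (r : 'I_n + 'I_n) (v : var G) : R :=
  match r, v with
  | inl i, inl e => (src e == i)%:R - beta * (dst e == i)%:R
  | inl _, inr _ => 0
  | inr i, inl e => (src e == i)%:R
  | inr i, inr k => - (val k == i)%:R
  end.

Definition basis_mx B : 'M[R]_(n + n, #|B|) :=
  \matrix_(r, c) WH_coef (split r) (enum_val c).

Record WH_basis B L U : Prop := WHBasis {
  WH_basis_disjoint : [disjoint L & U];
  WH_basis_cover : L :|: U = [set i | inr i \notin B];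
  WH_basis_unit : exists eqB : #|B| = (n + n)%N,
    castmx (erefl, eqB) (basis_mx B) \in unitmx }.

Record basic_solution B L U x y : Prop := BasicSolution {
  basic_eqs : WH_equations x y;
  basic_x : forall e, inl e \notin B -> x e = 0;
  basic_L : forall i, i \in L -> y i = 0;
  basic_U : forall i, i \in U -> y i = beta - beta ^+ (n - 1)%N }.

(* The basic solution of a basis exists and is unique, by invertibility. *)
Definition feasible_basis B L U : Prop :=
  WH_basis B L U /\ exists x y, basic_solution B L U x y /\ WH x y.

End Polytope.

Definition feasible_bases_stable (R : realType) n (G : rel 'I_n) (alpha : R) :=
  forall beta1 beta2 : R, alpha <= beta1 < 1 -> alpha <= beta2 < 1 ->
  forall (B : {set var G}) (L U : {set nonroot n}),
    feasible_basis beta1 B L U <-> feasible_basis beta2 B L U.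

(* Vertices of G': inl i is v_i and inr i is w_i. *)
Definition net_vertex (n : nat) := ('I_n + 'I_n)%type.

Definition net_arc n (G : rel 'I_n) (v : var G) : net_vertex n * net_vertex n :=
  match v with
  | inl e => (inr (src e), inl (dst e))
  | inr i => (inl (val i), inr (val i))
  end.

Definition net_E1 n (G : rel 'I_n) : {set net_vertex n * net_vertex n} :=
  [set net_arc (inl e : var G) | e : darc G].

Definition net_E2 n (G : rel 'I_n) : {set net_vertex n * net_vertex n} :=
  [set net_arc (inr i : var G) | i : nonroot n].

(* Arc multipliers; only meaningful on net_E1 G :|: net_E2 G. *)
Definition net_mult (R : realType) n (G : rel 'I_n) (beta : R)
    (a : net_vertex n * net_vertex n) : R :=
  if a \in net_E1 G then beta else 1.

Definition net_feasible_basis (R : realType) n (G : rel 'I_n) (beta : R)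
    (B' L' U' : {set net_vertex n * net_vertex n}) : Prop :=
  exists (B : {set var G}) (L U : {set nonroot n}),
    [/\ feasible_basis beta B L U,
        B' = [set net_arc v | v in B],
        L' = [set net_arc (inl e : var G) | e : darc G & inl e \notin B]
               :|: [set net_arc (inr i : var G) | i in L]
      & U' = [set net_arc (inr i : var G) | i in U]].

Section AugmentedTree.
Variables (R : realType) (T : finType) (mu : T * T -> R).
Implicit Types (D : {set T * T}).

(* A step (a, b) traverses the arc a, forward iff b is true. *)
Definition step_src (s : (T * T) * bool) : T := if s.2 then s.1.1 else s.1.2.
Definition step_dst (s : (T * T) * bool) : T := if s.2 then s.1.2 else s.1.1.

(* An oriented, not necessarily directed, cycle of the digraph (T, D). *)
Definition oriented_cycle D (c : seq ((T * T) * bool)) : bool :=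
  [&& c != [::], all (fun s => s.1 \in D) c,
      path.cycle (fun s t => step_dst s == step_src t) c,
      uniq (map step_src c) & uniq (map fst c)].

Definition cycle_arcs (c : seq ((T * T) * bool)) : {set T * T} :=
  [set a in map fst c].

Definition cycle_mult (c : seq ((T * T) * bool)) : R :=
  (\prod_(s <- c | s.2) mu s.1) / (\prod_(s <- c | ~~ s.2) mu s.1).

Definition breakeven c := cycle_mult c = 1.

Definition connected_arcs D : Prop :=
  forall u v : T, connect [rel a b | ((a, b) \in D) || ((b, a) \in D)] u v.

(* A cycle, as a subgraph, is determined by its arcs, so starting point and
   orientation are disregarded when counting cycles. *)
Definition augmented_tree D : Prop :=
  connected_arcs D /\
  exists2 c, oriented_cycle D c
    & forall c', oriented_cycle D c' -> cycle_arcs c' = cycle_arcs c.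

Definition good_augmented_tree D : Prop :=
  augmented_tree D /\ forall c, oriented_cycle D c -> ~ breakeven c.

End AugmentedTree.

(* Main.v *)
Require Import Defs.
From mathcomp Require Import all_boot all_order all_algebra.
From mathcomp Require Import reals.
From mathcomp Require Import ring lra zify.

Set Implicit Arguments.
Unset Strict Implicit.
Unset Printing Implicit Defensive.

Import Order.TTheory GRing.Theory Num.Theory.
Local Open Scope ring_scope.

(** Give the arc (p, q) of G' with multiplier mu the column that has 1 in row p
    and - mu in row q.  Up to row operations these columns form the coefficient
    matrix of the constraints, so the arcs of a basis B' are exactly as many as
    the vertices of G', and no nonzero flow supported on B' is balanced at every
    vertex (net_circulation_free).  Three consequences are combined.

    No breakeven cycle.  Pushing a unit of flow once around a breakeven cycle
    brings back exactly one unit, hence gives a nonzero balanced flow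
    (breakeven_circulation).

    Exactly one cycle, once B' is connected.  This is the cyclomatic number
    |B'| - |V'| + 1 = 1, read on circulations with all multipliers equal to 1:
    a nonzero circulation exists for lack of equations, and contains a cycle;
    if two cycles had different arc sets there would be two independent
    circulations, and then too few constraints would be left to force a
    potential constant along the arcs to be constant on V'
    (connected_augmented_tree).

    Connectedness.  This is where feasibility and the choice of beta enter.  Let
    K be a union of components of B' that contains w_1, and let W, V be the sets
    of indices i with w_i in K, respectively v_i in K.  The feasible bases are
    the same for every parameter in [alpha, 1), so beta may be replaced by some
    b as close to 1 as needed.  Let s = b^(n-1), q = b - s, let X be the total
    flow on the x-arcs within K and let u be the number of arcs at their upper
    bound that enter K minus the number of those that leave it.  Adding up the
    balance equations over K gives (cut_identity)
      (1 - b) X = (1 - s) + [v_1 in K] s (1 - b) + (|W| - |V|) s + u q.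
    As b tends to 1 every term but (|W| - |V|) s vanishes, so |W| = |V| = k.
    Dividing by 1 - b and letting b tend to 1 once more, where X tends to k,
    (1 - s)/(1 - b) to n - 1 and q/(1 - b) to n - 2, gives
      n - 1 + [v_1 in K] + u (n - 2) = k.
    Both sides are integers, so these equalities hold exactly as soon as b is
    close enough to 1 (cut_rounding).  On the other hand B' has exactly 2k arcs
    within K (circulation_free_card), and at most k^2 - [v_1 in K] of them can
    exist: one for each pair (w_i, v_j), where a pair with i = j stands for
    the y-arc of i, which is missing for i = 1 (card_arcs_within).  Thus
    k >= 2 + [v_1 in K].  If the complement of K were not empty, the same count
    would give n - k >= 2, so that k - 1 - [v_1 in K] would lie between 1 and
    n - 3 and be a multiple of n - 2, which is absurd (cut_arith). *)

(** * Balanced flows and cycles of a network with gains *)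

Lemma underdetermined (F : fieldType) (I J : finType) (A : {set I})
    (P : {set J}) (m : I -> J -> F) :
  (#|P| < #|A|)%N ->
  exists z : I -> F, [/\ exists2 i, i \in A & z i != 0,
    forall i, i \notin A -> z i = 0
    & forall j, j \in P -> \sum_(i in A) m i j * z i = 0].
Proof.
move=> ltPA.
pose M := \matrix_(i < #|A|, j < #|P|) m (enum_val i) (enum_val j).
have /rowV0Pn[v /sub_kermxP vM0 /rV0Pn[k0 vk0]] : kermx M != 0.
  by rewrite kermx_eq0 /row_free neq_ltn (leq_ltn_trans (rank_leq_col M)).
pose z i := \sum_(k < #|A| | enum_val k == i) v 0 k.
have zE k : z (enum_val k) = v 0 k.
  by rewrite /z (big_pred1 k) // => i; rewrite (inj_eq enum_val_inj).
exists z; split=> [|i iA|j jP].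
- by exists (enum_val k0); rewrite ?enum_valP ?zE.
- by rewrite /z big_pred0 // => k; apply: contraNF iA => /eqP<-; apply: enum_valP.
- rewrite big_enum_val.
  have /rowP/(_ (enum_rank_in jP j)) := vM0; rewrite !mxE; apply: etrans.
  by apply: eq_bigr => k _; rewrite zE !mxE enum_rankK_in // mulrC.
Qed.

Section Flows.
Variables (R : realType) (T : finType).
Implicit Types (mu : T * T -> R) (D : {set T * T}) (z : T * T -> R) (u : T).
Implicit Types (c : seq ((T * T) * bool)).

(** The net amount that the flow z on D takes out of u; an arc delivers mu times
    what enters it. *)
Definition excess mu D z u : R :=
  \sum_(a in D) ((a.1 == u)%:R - mu a * (a.2 == u)%:R) * z a.

Definition circulation_free mu D :=
  forall z, (forall u, excess mu D z u = 0) -> forall a, a \in D -> z a = 0.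

Definition arc_closed D (K : {set T}) :=
  forall a, a \in D -> (a.1 \in K) = (a.2 \in K).

Lemma arc_closedC D K : arc_closed D K -> arc_closed D (~: K).
Proof. by move=> clK a aD; rewrite !inE clK. Qed.

(** The columns of the arcs within K vanish outside the rows of K; were there
    more of them than rows, they would be dependent. *)
Lemma circulation_free_card_le mu D K : circulation_free mu D ->
  arc_closed D K -> (#|[set a in D | a.1 \in K]| <= #|K|)%N.
Proof.
move=> freeD clK; rewrite leqNgt; apply/negP.
case/(underdetermined (fun a u => (a.1 == u)%:R - mu a * (a.2 == u)%:R)).
move=> z [[a aDK /eqP za] zout zK]; apply: za.
move: aDK; rewrite inE => /andP[aD _]; apply: (freeD z) => // u.
have [uK|uK] := boolP (u \in K); last first.
  apply: big1 => b bD; have [bK|bK] := boolP (b.1 \in K); last first.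
    by rewrite zout ?mulr0 // inE (negPf bK) andbF.
  have bK2 : b.2 \in K by rewrite -clK.
  have /negPf-> : b.1 != u by apply: contraNneq uK => <-.
  have /negPf-> : b.2 != u by apply: contraNneq uK => <-.
  by rewrite mulr0 subrr mul0r.
rewrite -[RHS](zK u uK) /excess [LHS](bigID (fun a => a.1 \in K)) /=.
rewrite [X in _ + X]big1 ?addr0 => [|b /andP[_ bK]].
  by apply: eq_bigl => b; rewrite inE.
by rewrite zout ?mulr0 // inE (negPf bK) andbF.
Qed.

(** The bound for K and the bound for its complement add up to |D| = |T|, so
    both are attained. *)
Lemma circulation_free_card mu D K : circulation_free mu D ->
  #|D| = #|T| -> arc_closed D K -> #|[set a in D | a.1 \in K]| = #|K|.
Proof.
move=> freeD cardD clK; apply/eqP; rewrite eqn_leq (circulation_free_card_le freeD clK) /=.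
have leC := circulation_free_card_le freeD (arc_closedC clK).
rewrite -(leq_add2r #|~: K|) cardsC -cardD.
apply: leq_trans (leq_add (leqnn _) leC); rewrite -(cardsID [set a | a.1 \in K] D).
by rewrite leq_add // subset_leq_card //; apply/subsetP => a; rewrite !inE // andbC.
Qed.

Definition step_gain mu (s : (T * T) * bool) : R :=
  if s.2 then mu s.1 else (mu s.1)^-1.

Lemma cycle_multE mu c : cycle_mult mu c = \prod_(s <- c) step_gain mu s.
Proof.
rewrite [RHS](bigID (fun s => s.2)) /= /cycle_mult -prodfV.
by congr (_ * _); apply: eq_bigr => s; rewrite /step_gain; case: s.2.
Qed.

(** The flow that arises when an amount f enters the walk c at its source and is
    carried along it.  To move f from the head to the tail of an arc of
    multiplier mu, one cancels f / mu of the flow on that arc. *)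
Fixpoint push mu (f : R) c : T * T -> R := fun a =>
  if c is s :: c' then
    (if a == s.1 then (if s.2 then f else - (f / mu s.1)) else 0)
      + push mu (f * step_gain mu s) c' a
  else 0.

(** Along a walk the excesses at the intermediate vertices telescope: only the
    amount put in at the start and the amount arriving at the end remain. *)
Lemma excess_push mu D f s c : (forall a, mu a != 0) ->
  all (fun s => s.1 \in D) (s :: c) ->
  path (fun s t => step_dst s == step_src t) s c ->
  forall u, excess mu D (push mu f (s :: c)) u =
    f * (step_src s == u)%:R
    - f * \prod_(t <- s :: c) step_gain mu t * (step_dst (last s c) == u)%:R.
Proof.
move=> mu0 + + u; elim: c s f => [|t c IH] s f /=.
  rewrite andbT => sD _; rewrite big_seq1 /excess (bigD1 s.1) //= eqxx addr0.
  rewrite big1 => [|a /andP[_ /negPf->]]; last by rewrite add0r mulr0.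
  rewrite /step_gain /step_src /step_dst addr0.
  by case: s.2; [ring | field; exact: mu0].
case/and3P=> sD tD cD /andP[/eqP st ptc].
have := IH t (f * step_gain mu s); rewrite /= tD cD => /(_ erefl ptc) E.
transitivity (f * (step_src s == u)%:R
    - f * step_gain mu s * (step_dst s == u)%:R
    + excess mu D (push mu (f * step_gain mu s) (t :: c)) u); last first.
  by rewrite E st [in RHS]big_cons; ring.
rewrite /excess.
transitivity (\sum_(a in D) ((a.1 == u)%:R - mu a * (a.2 == u)%:R) *
     (if a == s.1 then if s.2 then f else - (f / mu s.1) else 0)
   + \sum_(a in D) ((a.1 == u)%:R - mu a * (a.2 == u)%:R) *
       push mu (f * step_gain mu s) (t :: c) a).
  by rewrite -big_split /=; apply: eq_bigr => a _; rewrite -mulrDr.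
congr (_ + _); rewrite (bigD1 s.1) //= eqxx.
rewrite big1 => [|a /andP[_ /negPf->]]; last by rewrite mulr0.
rewrite /step_gain /step_src /step_dst addr0.
by case: s.2; [ring | field; exact: mu0].
Qed.

Lemma push_neq0 mu f c : (forall a, mu a != 0) -> f != 0 ->
  uniq (map fst c) -> forall a, (push mu f c a != 0) = (a \in map fst c).
Proof.
move=> mu0 + + a; elim: c f => [|s c IH] f f0 /=; first by rewrite eqxx.
case/andP=> sc uc; rewrite inE.
have f0' : f * step_gain mu s != 0.
  by rewrite mulf_neq0 // /step_gain; case: s.2; rewrite ?invr_eq0.
have {IH} := IH _ f0' uc; have [-> |_ <-] /= := eqVneq a s.1.
  rewrite (negPf sc) => /negbFE/eqP->; rewrite addr0.
  by case: s.2 => //; rewrite oppr_eq0 mulf_neq0 ?invr_eq0.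
by rewrite add0r.
Qed.

Lemma breakeven_circulation mu D c : (forall a, mu a != 0) ->
  oriented_cycle D c -> breakeven mu c ->
  exists2 z, (forall u, excess mu D z u = 0)
    & forall a, (z a != 0) = (a \in cycle_arcs c).
Proof.
move=> mu0 /and5P[c0 cD cyc _ uc]; rewrite /breakeven cycle_multE => mult1.
exists (push mu 1 c) => [u|a]; last by rewrite push_neq0 ?oner_eq0 // inE.
case: c c0 cD cyc {uc} mult1 => // s c _ cD; rewrite /= rcons_path.
case/andP=> psc /eqP lastE mult1.
by rewrite excess_push // mult1 lastE !mul1r subrr.
Qed.

Lemma circulation_free_not_breakeven mu D c : (forall a, mu a != 0) ->
  circulation_free mu D -> oriented_cycle D c -> ~ breakeven mu c.
Proof.
move=> mu0 freeD cycD bec.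
have [z exz zc] := breakeven_circulation mu0 cycD bec.
case/and5P: cycD; case: c zc {bec} => // s c zc _ /andP[sD _] _ _ _.
by have := zc s.1; rewrite (freeD z) // eqxx !inE eqxx.
Qed.

(** The map from a vertex u to the end of a chosen step of S out of u is
    eventually periodic, and a period of it is a cycle.  Its arcs are distinct
    because its sources are, and because S uses each arc in one direction. *)
Lemma cycle_of_steps D (S : pred ((T * T) * bool)) s0 :
  S s0 -> (forall s, S s -> s.1 \in D) ->
  (forall a, ~~ (S (a, true) && S (a, false))) ->
  (forall s, S s -> exists2 t, S t & step_src t = step_dst s) ->
  exists c, oriented_cycle D c.
Proof.
move=> Ss0 SD Sor Snext.
pose st u := odflt s0 [pick t | S t && (step_src t == u)].
pose g u := step_dst (st u).
pose good u := [exists t, S t && (step_src t == u)].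
have stP u : good u -> S (st u) /\ step_src (st u) = u.
  move=> /existsP[t tP]; rewrite /st; case: pickP => [t' /andP[? /eqP]|/(_ t)] //.
  by rewrite tP.
have good_g u : good u -> good (g u).
  case/stP=> /Snext[t St tg] _; apply/existsP; exists t.
  by rewrite St tg eqxx.
have good_iter i : good (iter i g (step_src s0)).
  elim: i => [|i IH]; last exact: good_g.
  by apply/existsP; exists s0; rewrite Ss0 eqxx.
set u0 := step_src s0 in good_iter.
(* The orbit of u0 is duplicate-free and its order-th iterate falls back on the
   iterate i, so the part of the orbit from i on is a period. *)
have /trajectP[i lti itE] : looping g u0 (fingraph.order g u0) by exact: looping_order.
set m := fingraph.order g u0 in lti itE.
pose y := iter i g u0.
have [m' mE] : {m' | (m = i + m'.+1)%N}.
  by exists (m - i).-1; rewrite prednK ?subn_gt0 // subnKC // ltnW.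
have uniq_tr : uniq (traject g y m'.+1).
  have := orbit_uniq g u0; rewrite /orbit -/m mE trajectD cat_uniq.
  by case/and3P.
have yE : iter m' g (g y) = y.
  by rewrite -iterSr -[RHS]itE mE addnC iterD.
have cyc_tr : fcycle g (traject g y m'.+1).
  by rewrite /= -[X in rcons _ X]yE -trajectSr fpath_traject.
have good_tr : all good (traject g y m'.+1).
  by apply/allP => _ /trajectP[j _ ->]; rewrite /y -iterD good_iter.
have tr_good : {in traject g y m'.+1, forall u, good u} by exact/allP.
exists (map st (traject g y m'.+1)); apply/and5P; split=> //.
- by rewrite all_map; apply: sub_all good_tr => u /stP[/SD].
- rewrite cycle_map; apply: sub_in_cycle good_tr cyc_tr => a b ga gb /= /eqP<-.
  by have [_ ->] := stP _ (good_g _ ga).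
- by rewrite -map_comp map_id_in // => u /tr_good/stP[].
- rewrite -map_comp map_inj_in_uniq // => a b /tr_good/stP[Sa aE] /tr_good/stP[Sb bE].
  rewrite /= -{2}aE -{2}bE; move: Sa Sb (Sor (st b).1) {aE bE}.
  case: (st a) (st b) => [e []] [e' []] /=; move=> + + + ?; subst=> // -> -> //.
Qed.

(** Traverse each arc of the support in the direction in which the flow is
    positive: flow that arrives at a vertex has to leave it again. *)
Lemma circulation_cycle D z a : (forall u, excess (fun=> 1) D z u = 0) ->
  a \in D -> z a != 0 -> exists c, oriented_cycle D c.
Proof.
move=> exz aD za.
pose S (s : (T * T) * bool) := (s.1 \in D) && (if s.2 then 0 < z s.1 else z s.1 < 0).
have Sa : S (a, 0 < z a).
  by rewrite /S /= aD /=; case: ltgtP za => // ->; rewrite eqxx.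
apply: (cycle_of_steps Sa) => [s /andP[]|b|s Ss] //.
  by apply/negP => /andP[/andP[_ zb] /andP[_ /lt_gtF]]; rewrite /= zb.
have [sl|sl] := eqVneq (step_src s) (step_dst s); first by exists s.
set u := step_dst s in sl *.
have [/existsP[t /andP[St /eqP tu]]|no_out] :=
  boolP [exists t, S t && (step_src t == u)]; first by exists t.
have out t : S t -> step_src t != u.
  by move=> St; apply: contraNneq no_out => tu; apply/existsP; exists t; rewrite St tu eqxx.
have term_le0 b : b \in D -> 0 <= - (((b.1 == u)%:R - 1 * (b.2 == u)%:R) * z b).
  move=> bD; rewrite mul1r; case: (ltgtP (z b) 0) => zb; last by rewrite zb mulr0 oppr0.
    have := out (b, false); rewrite /S /step_src /= bD zb => /(_ erefl) /negPf->.
    by rewrite subr0 -mulrN mulr_ge0 // ?oppr_ge0 ltW.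
  have := out (b, true); rewrite /S /step_src /= bD zb => /(_ erefl) /negPf->.
  by rewrite sub0r mulNr opprK mulr_ge0 // ltW.
have /psumr_eq0P : \sum_(b in D) - (((b.1 == u)%:R - 1 * (b.2 == u)%:R) * z b) = 0.
  by rewrite sumrN [X in - X](exz u) oppr0.
case/andP: (Ss) => sD ss /(_ term_le0 s.1 sD) /eqP; rewrite oppr_eq0 mul1r mulf_eq0.
move: ss sl; rewrite /u /step_src /step_dst; case: s.2 => zs sl.
  by rewrite (negPf sl) eqxx sub0r oppr_eq0 oner_eq0 /= gt_eqF.
by rewrite eqxx (negPf sl) subr0 oner_eq0 /= lt_eqF.
Qed.

(** Duality of the incidence matrix with its transpose: a circulation is
    orthogonal to every potential difference. *)
Lemma excess_potential D z (p : T -> R) :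
  \sum_u p u * excess (fun=> 1) D z u = \sum_(a in D) (p a.1 - p a.2) * z a.
Proof.
have pick v : \sum_u p u * (v == u)%:R = p v.
  rewrite (bigD1 v) //= eqxx mulr1 big1 ?addr0 // => u.
  by rewrite eq_sym => /negPf->; rewrite mulr0.
under eq_bigr do rewrite mulr_sumr.
rewrite exchange_big /=; apply: eq_bigr => a _.
rewrite -[p a.1]pick -[p a.2]pick -sumrB mulr_suml.
by apply: eq_bigr => u _; ring.
Qed.

(** If z2 does not vanish at some b, then prescribe p = 0 at one vertex and
    p constant along all arcs but a and b.  These are |T| - 1 equations, so some
    p <> 0 satisfies them.  Orthogonality to z2, and then to z1, makes p constant
    along b and a as well, hence p = 0 since D is connected. *)
Lemma unicyclic_circulations D z1 z2 a : connected_arcs D -> #|D| = #|T| ->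
  (forall u, excess (fun=> 1) D z1 u = 0) ->
  (forall u, excess (fun=> 1) D z2 u = 0) ->
  a \in D -> z1 a != 0 -> z2 a = 0 -> forall b, b \in D -> z2 b = 0.
Proof.
move=> conD cardD ex1 ex2 aD z1a z2a b bD; apply/eqP/negP => /negP z2b.
have ab : a != b by apply: contraNneq z2b => <-; rewrite z2a.
(* None indexes the equation p a.1 = 0, Some e the equation p e.1 = p e.2. *)
pose m (u : T) (r : option (T * T)) : R :=
  if r is Some e then (e.1 == u)%:R - (e.2 == u)%:R else (u == a.1)%:R.
have [] := @underdetermined _ _ _ [set: T] (None |: (Some @: (D :\ a :\ b))) m.
  rewrite cardsU1 card_imset; last by move=> ? ? [].
  have -> : None \notin Some @: (D :\ a :\ b) by apply/imsetP => -[].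
  rewrite cardsT -cardD (cardsD1 a D) aD (cardsD1 b (D :\ a)) !inE bD eq_sym ab.
  by rewrite ltnS.
move=> p [[u _ pu0] _ pD].
have pa : p a.1 = 0.
  have := pD None; rewrite !inE => /(_ isT); rewrite (bigD1 a.1) ?inE //= eqxx mul1r.
  by rewrite big1 ?addr0 // => v /andP[_ /negPf->]; rewrite mul0r.
have dp e : e \in D -> e != a -> e != b -> p e.1 - p e.2 = 0.
  move=> eD ea eb; have := pD (Some e); rewrite inE /= mem_imset; last by move=> ? ? [].
  rewrite !inE ea eb eD => /(_ isT) <-.
  have pick v : \sum_(i in [set: T]) (v == i)%:R * p i = p v.
    rewrite (bigD1 v) ?inE //= eqxx mul1r big1 ?addr0 // => i /andP[_].
    by rewrite eq_sym => /negPf->; rewrite mul0r.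
  rewrite -[LHS](congr2 (fun x y => x - y) (pick e.1) (pick e.2)) -sumrB.
  by apply: eq_bigr => i _; rewrite mulrBl.
have dual z : (forall u, excess (fun=> 1) D z u = 0) ->
    (p a.1 - p a.2) * z a + (p b.1 - p b.2) * z b = 0.
  move=> exz; have <- : \sum_u p u * excess (fun=> 1) D z u = 0.
    by apply: big1 => v _; rewrite exz mulr0.
  rewrite excess_potential (bigD1 a) //= (bigD1 b) /=; last by rewrite bD eq_sym.
  by rewrite big1 ?addr0 // => e /andP[/andP[eD ea] eb]; rewrite dp ?mul0r.
have dpb : p b.1 - p b.2 = 0.
  have /eqP := dual _ ex2.
  by rewrite z2a mulr0 add0r mulf_eq0 (negPf z2b) orbF => /eqP.
have dpa : p a.1 - p a.2 = 0.
  have /eqP := dual _ ex1.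
  by rewrite dpb mul0r addr0 mulf_eq0 (negPf z1a) orbF => /eqP.
have pconst e : e \in D -> p e.1 = p e.2.
  move=> eD; apply/eqP; rewrite -subr_eq0.
  have [->|ea] := eqVneq e a; first by rewrite dpa.
  have [->|eb] := eqVneq e b; first by rewrite dpb.
  by rewrite dp.
have /connectP[s sp lastE] := conD a.1 u.
case/eqP: pu0; rewrite lastE -pa.
elim: s (a.1) sp {lastE} => //= v s IH w /andP[wv /IH ->].
by case/orP: wv => /pconst /= ->.
Qed.

Lemma connected_augmented_tree D : connected_arcs D -> #|D| = #|T| -> (0 < #|T|)%N ->
  augmented_tree D.
Proof.
move=> conD cardD /card_gt0P[t0 _]; split=> //.
have [c cycc] : exists c, oriented_cycle D c.
  (* The balance at t0 follows from the others, since all excesses sum to 0. *)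
  have [] := @underdetermined R _ _ D [set~ t0]
    (fun a u => (a.1 == u)%:R - 1 * (a.2 == u)%:R).
    by rewrite cardD cardsC1 ltn_predL; apply/card_gt0P; exists t0.
  move=> z [[a aD za] _ exz]; apply: circulation_cycle aD za.
  have ext u : u != t0 -> excess (fun=> 1) D z u = 0.
    by move=> ut; apply: exz; rewrite !inE.
  move=> u; have [-> |/ext//] := eqVneq u t0.
  have := excess_potential D z (fun=> 1); rewrite (bigD1 t0) //= mul1r.
  rewrite big1 ?addr0 => [->|v /ext ->]; last by rewrite mulr0.
  by apply: big1 => e _; rewrite subrr mul0r.
have circ c' : oriented_cycle D c' -> exists2 z, (forall u, excess (fun=> 1) D z u = 0)
    & forall a, (z a != 0) = (a \in cycle_arcs c').
  move=> cyc'; apply: breakeven_circulation => //; first by move=> _; apply: oner_neq0.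
  by rewrite /breakeven /cycle_mult !big1_eq divr1.
have sub c1 c2 : oriented_cycle D c1 -> oriented_cycle D c2 ->
    cycle_arcs c1 \subset cycle_arcs c2.
  move=> cyc1 cyc2; have [z1 ex1 z1E] := circ _ cyc1; have [z2 ex2 z2E] := circ _ cyc2.
  apply/subsetP => a ac1; apply/negPn/negP; rewrite -z2E negbK => /eqP z2a.
  have cD (d : seq ((T * T) * bool)) e : oriented_cycle D d -> e \in cycle_arcs d -> e \in D.
    by case/and5P=> _ /allP dD _ _ _; rewrite inE => /mapP[s /dD sD ->].
  have z2D := unicyclic_circulations conD cardD ex1 ex2 (cD _ _ cyc1 ac1).
  rewrite z1E ac1 in z2D; have {}z2D := z2D isT z2a.
  case/and5P: (cyc2) => c20 c2D _ _ _.
  case: (c2) c20 c2D z2E => // s c2' _ /andP[/z2D sD _] /(_ s.1).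
  by rewrite sD eqxx !inE eqxx.
by exists c => // c' cyc'; apply/eqP; rewrite eqEsubset !sub.
Qed.

End Flows.

(** * The basis columns as a network *)

Lemma castmx_unit_inj (F : fieldType) (m p : nat) (eq_pm : p = m)
    (M : 'M[F]_(m, p)) (w : 'cV[F]_p) :
  castmx (erefl, eq_pm) M \in unitmx -> M *m w = 0 -> w = 0.
Proof.
case: m / eq_pm M => M; rewrite castmx_id => unitM Mw0.
by rewrite -(mulKmx unitM w) Mw0 mulmx0.
Qed.

Section Network.
Variables (R : realType) (n : nat) (G : rel 'I_n).
Implicit Types (b : R) (B : {set var G}) (L U : {set nonroot n}).

Lemma net_arc_inj : injective (@net_arc n G).
Proof.
by move=> [e|i] [f|j] //= [] => [srcE dstE|/val_inj-> //]; congr inl;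
  apply/val_inj/eqP; rewrite -pair_eqE /pair_eq /= -/(src e) srcE -/(dst e) dstE !eqxx.
Qed.

Lemma net_multE b (v : var G) :
  net_mult G b (net_arc v) = if v is inl _ then b else 1 :> R.
Proof.
rewrite /net_mult; case: v => [e|i].
  by have -> : net_arc (inl e : var G) \in net_E1 G by apply/imsetP; exists e.
by case: imsetP => // -[].
Qed.

Lemma WH_basis_kernel b B L U (z : var G -> R) : WH_basis b B L U ->
  (forall r, \sum_(v in B) WH_coef b r v * z v = 0) -> forall v, v \in B -> z v = 0.
Proof.
case=> _ _ [eqB unitB] kerz v vB.
have /(castmx_unit_inj unitB)/colP/(_ (enum_rank_in vB v)) :
    basis_mx b B *m \col_c z (enum_val c) = 0.
  apply/colP => r; rewrite !mxE -[RHS](kerz (split r)) [RHS]big_enum_val.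
  by apply: eq_bigr => c _; rewrite !mxE.
by rewrite !mxE enum_rankK_in.
Qed.

(** The row of w_i is the outflow equation of i, and the row of v_i is the
    conservation equation of i minus its outflow equation. *)
Lemma net_circulation_free b B L U : WH_basis b B L U ->
  circulation_free (net_mult G b) (@net_arc n G @: B).
Proof.
move=> basisB z exz _ /imsetP[v vB ->].
have bal u : \sum_(v in B) (((net_arc v).1 == u)%:R
    - net_mult G b (net_arc v) * ((net_arc v).2 == u)%:R) * z (net_arc v) = 0.
  have := exz u; rewrite /excess big_imset //; by move=> ? ? _ _ /net_arc_inj.
apply: (WH_basis_kernel (z := z \o @net_arc n G) basisB _ vB) => r /=.
have out i : \sum_(v in B) WH_coef b (inr i) v * z (net_arc v) = 0.
  rewrite -[RHS](bal (inr i)); apply: eq_bigr => -[e|k] _; rewrite net_multE //=.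
    by rewrite mulr0 subr0.
  by rewrite mul1r sub0r.
case: r => i //; rewrite -[RHS](addr0 0) -[X in X + _](out i) -[X in _ + X](bal (inl i)).
rewrite -big_split; apply: eq_bigr => -[e|k] _; rewrite net_multE /= -mulrDl; congr (_ * _).
  by rewrite sub0r.
by rewrite mulr0 subr0 addNr.
Qed.

Lemma net_card b B L U : WH_basis b B L U ->
  #|@net_arc n G @: B| = #|{: net_vertex n}|.
Proof.
case=> _ _ [eqB _]; rewrite card_imset; last exact: net_arc_inj.
by rewrite eqB card_sum card_ord.
Qed.

Lemma sum_outflow (x : darc G -> R) (W : {set 'I_n}) :
  \sum_(i in W) outflow x i = \sum_(e | src e \in W) x e.
Proof.
rewrite (partition_big (fun e => src e) (mem W)) //=; apply: eq_bigr => i iW.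
by apply: eq_bigl => e; rewrite val_eqE; case: eqP => [->|]; rewrite ?iW ?andbF.
Qed.

Lemma sum_inflow (x : darc G -> R) (V : {set 'I_n}) :
  \sum_(i in V) inflow x i = \sum_(e | dst e \in V) x e.
Proof.
rewrite (partition_big (fun e => dst e) (mem V)) //=; apply: eq_bigr => i iV.
by apply: eq_bigl => e; rewrite val_eqE; case: eqP => [->|]; rewrite ?iV ?andbF.
Qed.

(** X is the total x-flow within the cut, counted once by the vertices w_i with i
    in W and once by the vertices v_i with i in V.  The y-flows of the indices
    in both V and W cancel in the difference; an index in just one of them has
    its y-variable nonbasic, hence equal to 0 or q. *)
Lemma cut_identity b B L U x y (root : 'I_n) (V W : {set 'I_n}) :
  let s := b ^+ (n - 1)%N in let q := b - s in
  (2 <= n)%N -> 0 < b < 1 -> root = 0%N :> nat ->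
  WH_basis b B L U -> basic_solution b B L U x y -> WH b x y ->
  (forall e, inl e \in B -> (src e \in W) = (dst e \in V)) ->
  (forall i, inr i \in B -> (val i \in V) = (val i \in W)) ->
  root \in W ->
  exists (X Y : R) (u : int), [/\ X = #|W|%:R * s + (1 - s) + Y,
    (1 - b) * X = (1 - s) + (root \in V)%:R * s * (1 - b)
                  + (#|W|%:R - #|V|%:R) * s + u%:~R * q,
    0 <= Y <= n%:R * q & `|u%:~R| <= n%:R :> R].
Proof.
move=> s q n2 b01 root0 [_ coverB _] [[con0 con out0 out] xB yL yU] [_ ybnd _] clx cly rootW.
(* ye extends y to the root, where it is 1 - s. *)
pose ye i := outflow x i - s.
have neroot (i : nonroot n) : val i != root by apply: contraTneq (valP i) => ->; rewrite root0.
have yeE i (i0 : i != root) : exists2 k : nonroot n, val k = i & ye i = y k.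
  have i0' : i != 0%N :> nat by rewrite -root0 val_eqE.
  exists (exist _ i i0') => //=; rewrite /ye /s.
  by rewrite -(out (exist _ i i0')) /= opprB addrCA subrr addr0.
have ye_bnd i : i != root -> 0 <= ye i <= q by case/yeE=> k _ ->; apply: ybnd.
have inE' i : i != root -> b * inflow x i = s + ye i.
  case/yeE=> k ki _; rewrite /ye addrCA subrr addr0.
  by have /eqP := con k; rewrite subr_eq0 ki => /eqP.
have in0 : b * inflow x root = s * b.
  have n0 : (0 < n)%N by apply: leq_trans n2.
  rewrite root0 /s mulrC -exprSr; have /eqP := con0; rewrite out0 => /eqP E.
  by rewrite subn1 prednK //; lra.
have ye_eq i : i != root -> (i \in W) != (i \in V) -> ye i = (ye i == q)%:R * q.
  move=> i0 WV; case: (ye i =P q) => [->|]; first by rewrite mul1r.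
  case: (yeE _ i0) => k ki -> neq_q; rewrite mul0r.
  have : k \in L :|: U.
    rewrite coverB inE; apply: contraNN WV => kB.
    by have := cly _ kB; rewrite ki => ->.
  by rewrite inE => /orP[/yL|/yU].
have flowE : \sum_(i in W) outflow x i = \sum_(i in V) inflow x i.
  rewrite sum_outflow sum_inflow big_mkcond [RHS]big_mkcond; apply: eq_bigr => e _.
  by case: (boolP (inl e \in B)) => [/clx->|/xB->] //; do !case: ifP.
pose Yw := \sum_(i | i != root) (i \in W)%:R * ye i.
pose Yv := \sum_(i | i != root) (i \in V)%:R * ye i.
pose u : int := \sum_(i | i != root) ((i \in W)%:R - (i \in V)%:R) * (ye i == q)%:R.
have uE : Yw - Yv = u%:~R * q.
  rewrite /Yw /Yv -sumrB rmorph_sum mulr_suml; apply: eq_bigr => i i0.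
  rewrite rmorphM rmorphB !rmorph_nat -mulrBl -mulrA.
  have [<-|/(ye_eq _ i0) <-//] := eqVneq (i \in W) (i \in V).
  by rewrite subrr !mul0r.
have split_root (A : {set 'I_n}) (f : 'I_n -> R) : \sum_(i in A) (s + f i)
    = #|A|%:R * s + ((root \in A)%:R * f root + \sum_(i | i != root) (i \in A)%:R * f i).
  rewrite big_split /= sumr_const mulr_natl; congr (_ + _).
  rewrite [LHS]big_mkcond (bigD1 root) //=; congr (_ + _).
    by case: ifP; rewrite ?mul1r ?mul0r.
  by apply: eq_bigr => i _; case: ifP; rewrite ?mul1r ?mul0r.
have sumW : \sum_(i in W) outflow x i = #|W|%:R * s + (1 - s) + Yw.
  have -> : \sum_(i in W) outflow x i = \sum_(i in W) (s + ye i).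
    by apply: eq_bigr => i _; rewrite /ye addrCA subrr addr0.
  by rewrite split_root rootW mul1r addrA /ye root0 out0.
have sumV : b * \sum_(i in V) inflow x i
    = #|V|%:R * s + (root \in V)%:R * (s * b - s) + Yv.
  pose de i := b * inflow x i - s.
  have -> : b * \sum_(i in V) inflow x i = \sum_(i in V) (s + de i).
    by rewrite mulr_sumr; apply: eq_bigr => i _; rewrite /de addrCA subrr addr0.
  rewrite split_root addrA {1}/de in0; congr (_ + _); apply: eq_bigr => i i0.
  by rewrite /de inE' // addrAC subrr add0r.
exists (\sum_(i in W) outflow x i), Yw, u; split=> //.
- by rewrite mulrBl mul1r {2}flowE sumV sumW -uE; ring.
- rewrite sumr_ge0 /= => [|i /ye_bnd/andP[? _]]; last by rewrite mulr_ge0.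
  have q0 : 0 <= q.
    case/andP: b01 => b0 b1; rewrite subr_ge0 -[leRHS]expr1.
    by rewrite ler_wiXn2l ?(ltW b0, ltW b1) // subn_gt0.
  rewrite mulr_natl -[X in _ *+ X]card_ord -sumr_const.
  rewrite [leLHS]big_mkcond; apply: ler_sum => i _; case: ifP => // /ye_bnd/andP[? ?].
  by case: (i \in W); rewrite ?mul1r ?mul0r.
- rewrite /u rmorph_sum; apply: le_trans (ler_norm_sum _ _ _) _.
  rewrite -[X in _ <= X%:R]card_ord -sumr_const [leLHS]big_mkcond.
  apply: ler_sum => i _; case: ifP => // _.
  by case: (i \in W) (i \in V) (_ == q) => [] [] [];
    rewrite /= ?(subrr, subr0, sub0r, mulr0, mulr1, mulN1r, mulrN1);
    rewrite ?(rmorphN, rmorph1, rmorph0, normrN, normr0, normr1) ?ler01.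
Qed.

End Network.

(** * Integrality for parameters close to 1 *)

Lemma powers_near_one (R : realFieldType) (b : R) j :
  0 < b < 1 -> 1 - j%:R * (1 - b) <= b ^+ j <= 1.
Proof.
case/andP=> b0 b1; rewrite exprn_ile1 ?(ltW b0, ltW b1) // andbT.
elim: j => [|j IH]; first by rewrite mul0r subr0.
rewrite exprS -natr1; apply: le_trans (ler_wpM2l (ltW b0) IH).
have : 0 <= j%:R * (1 - b) ^+ 2 by rewrite mulr_ge0 ?sqr_ge0.
by lra.
Qed.

Lemma int_eq0_of_norm_lt1 (R : realDomainType) (m : int) : `|m%:~R : R| < 1 -> m = 0.
Proof.
rewrite -intr_norm -[1]/(1%:~R) ltr_int => m1.
by apply/eqP; rewrite -normr_eq0; lia.
Qed.

(** Each quantity that must be an integer is computed up to an error less than 1.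
    With h = n (1 - b), all powers b^j with j <= n lie in [1 - h, 1]; the errors
    are sums of a few terms bounded by h, n h and n^2 h, and the hypothesis on
    1 - b says that n^2 h <= 1/8. *)
Lemma cut_rounding (R : realFieldType) (n w v : nat) (r : bool) (b X Y : R) (u : int) :
  let s := b ^+ (n - 1)%N in let q := b - s in
  (2 <= n)%N -> (w <= n)%N -> 0 < b < 1 ->
  8 * n%:R ^+ 3 * (1 - b) <= 1 ->
  X = w%:R * s + (1 - s) + Y ->
  (1 - b) * X = (1 - s) + r%:R * s * (1 - b) + (w%:R - v%:R) * s + u%:~R * q ->
  0 <= Y <= n%:R * q -> `|u%:~R| <= n%:R :> R ->
  w = v /\ n%:Z - 1 + r%:Z + u * (n%:Z - 2) = w%:Z.
Proof.
move=> s q n2 wn b01 b_close XE cutE Y_bnd u_bnd.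
pose N : R := n%:R; pose h := N * (1 - b).
have N2 : 2 <= N by rewrite ler_nat.
have /andP[b0 b1] := b01.
have h0 : 0 <= h by rewrite mulr_ge0 //; lra.
have hNN : N * (N * h) <= 1 / 8 by rewrite /h; move: b_close; rewrite -/N; nra.
have hN : N * h <= 1 / 16 by nra.
have h32 : h <= 1 / 32 by nra.
have pow_bnd j : (j <= n)%N -> 1 - h <= b ^+ j <= 1.
  move=> jn; have /andP[lo ->] := powers_near_one j b01; rewrite andbT; apply: le_trans lo.
  by rewrite lerD2l lerN2 ler_wpM2r ?ler_nat //; lra.
have /andP[s_lo s_hi] : 1 - h <= s <= 1 by apply: pow_bnd; rewrite leq_subr.
(* S = (1 - s) / (1 - b), which tends to n - 1; also q = (1 - b) (S - 1). *)
pose S := \sum_(j < n - 1) b ^+ j.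
have sS : 1 - s = (1 - b) * S by rewrite -[1 - s]opprB subrX1 -mulNr opprB.
have nE : (n - 1)%:R = N - 1 :> R by rewrite natrB // ltnW.
have S_hi : S <= N - 1.
  rewrite -nE -[X in _ <= X%:R]card_ord -sumr_const; apply: ler_sum => j _.
  by have /andP[] := pow_bnd j (ltnW (leq_trans (ltn_ord j) (leq_subr _ _))).
have S_lo : (N - 1) * (1 - h) <= S.
  rewrite -nE mulr_natl -[X in _ *+ X]card_ord -sumr_const; apply: ler_sum => j _.
  by have /andP[] := pow_bnd j (ltnW (leq_trans (ltn_ord j) (leq_subr _ _))).
have qS : q = (1 - b) * (S - 1) by rewrite mulrBr mulr1 -sS /q; ring.
have /andP[Y0 Yq] := Y_bnd.
have wN : 0 <= (w%:R : R) <= N by rewrite ler0n ler_nat.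
have r01 : 0 <= (r%:R : R) <= 1 by case: r {cutE} => /=; rewrite ?lexx ler01.
have q_hi : q <= h by rewrite /q; lra.
have q0 : 0 <= q.
  rewrite subr_ge0 -[leRHS]expr1 ler_wiXn2l ?(ltW b0, ltW b1) //.
  by rewrite subn_gt0.
have NqNh : N * q <= N * h by rewrite ler_wpM2l //; lra.
have /andP[uN1 uN2] : - N <= u%:~R <= N by rewrite -ler_norml.
have uq : - (N * q) <= u%:~R * q <= N * q by rewrite -mulNr !ler_wpM2r.
have e_h : 1 - b <= h / 2.
  by have : 0 <= (N - 2) * (1 - b) by [rewrite mulr_ge0 //; lra]; rewrite /h; lra.
have X_bnd : w%:R - N * h <= X <= w%:R + h + N * h.
  by rewrite XE; nra.
have wv : w = v.
  apply/eqP; rewrite -(eqr_nat int) -subr_eq0; apply/eqP/(@int_eq0_of_norm_lt1 R).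
  rewrite rmorphB !rmorph_nat ltr_norml.
  have /andP[d_lo d_hi] : - (1 / 4) <= (w%:R - v%:R) * s <= 1 / 4.
    have e0 : 0 <= 1 - b by lra.
    have eX0 : 0 <= (1 - b) * (X + 1) by apply: mulr_ge0 => //; lra.
    have eX1 : 0 <= (1 - b) * (N + 1 - X) by apply: mulr_ge0 => //; lra.
    have hE : h = N * (1 - b) by [].
    have rs0 : 0 <= r%:R * s * (1 - b) <= 1 - b.
      rewrite mulr_ge0 ?ler_piMl // ?mulr_ge0 ?mulr_ile1 //; lra.
    by lra.
  have s0 : 0 < s by lra.
  by rewrite -(ltr_pM2r s0) -[X in _ && X](ltr_pM2r s0); lra.
split=> //; apply/eqP; rewrite -subr_eq0; apply/eqP/(@int_eq0_of_norm_lt1 R).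
rewrite !(rmorphB, rmorphD, rmorphM) /= -!pmulrn -/N.
have XS : X = S + r%:R * s + u%:~R * (S - 1).
  have e0 : 1 - b != 0 by rewrite subr_eq0 gt_eqF.
  by apply: (mulfI e0); rewrite cutE wv qS sS; ring.
have /andP[t0 t1] : 0 <= N - 1 - S <= N * h by lra.
have /andP[ut0 ut1] : - (1 / 8) <= u%:~R * (N - 1 - S) <= 1 / 8.
  rewrite -ler_norml normrM; apply: le_trans hNN.
  by apply: ler_pM => //; rewrite ger0_norm.
have /andP[rs0 rs1] : 0 <= r%:R * (1 - s) <= h.
  by case: (r); rewrite ?mul1r ?mul0r; lra.
by rewrite ltr_norml; lra.
Qed.

(** If k < n, the two arc counts force k >= 2 + r and n - k >= 2, so that
    (u + 1) (n - 2) = k - 1 - r would lie strictly between 0 and n - 2. *)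
Lemma cut_arith (n k : nat) (r : bool) (u : int) : (0 < k <= n)%N ->
  (k + k + r <= k * k)%N -> ((n - k) + (n - k) <= (n - k) * (n - k))%N ->
  n%:Z - 1 + r%:Z + u * (n%:Z - 2) = k%:Z -> k = n.
Proof.
move=> /andP[k0 kn] arcsK arcsC eq_u; apply/eqP; rewrite eqn_leq kn leqNgt.
apply/negP => ltkn.
have k_ge : (2 + r <= k)%N.
  by case: k k0 {kn arcsC eq_u ltkn} arcsK => [|[|[|k]]] //; case: r.
have c_ge : (2 <= n - k)%N.
  by case: (n - k)%N arcsC (subn_gt0 k n) => [|[|c]] //; rewrite ltkn.
pose m : int := n%:Z - 2.
have eq_um : (u + 1) * m = k%:Z - 1 - r%:Z by rewrite mulrDl mul1r /m; lia.
have m0 : 0 < m by rewrite /m; lia.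
have [u0|u0] := leP (u + 1) 0.
  by have : (u + 1) * m <= 0 by [rewrite pmulr_lle0]; lia.
have : m <= (u + 1) * m by rewrite ler_peMl //; lia.
by rewrite eq_um /m; lia.
Qed.

(** * Connectedness of a feasible basis *)

Section Connectivity.
Variables (R : realType) (n : nat) (G : rel 'I_n).
Hypothesis G_loopless : irreflexive G.

(** An arc within the cut is determined by its pair of indices in W x V: since G
    has no loops, the diagonal pairs are free for the y-arcs, and the root pair
    is never used. *)
Lemma card_arcs_within (B : {set var G}) (V W : {set 'I_n}) (root : 'I_n) :
  root = 0%N :> nat ->
  (forall e, inl e \in B -> (src e \in W) = (dst e \in V)) ->
  (forall i, inr i \in B -> (val i \in V) = (val i \in W)) ->
  (#|[set v in B | match v with inl e => src e \in W | inr i => val i \in V end]|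
     + (root \in V :&: W) <= #|W| * #|V|)%N.
Proof.
move=> root0 clx cly.
pose ends (v : var G) :=
  match v with inl e => (src e, dst e) | inr i => (val i, val i) end.
have loopless (e : darc G) : src e != dst e.
  by apply/eqP => E; have := valP e; rewrite -/(src e) -/(dst e) E G_loopless.
have ends_inj : injective ends.
  move=> [e|i] [f|j] //= [] => [|||/val_inj-> //].
  - move=> srcE dstE; congr inl; apply/val_inj/eqP.
    by rewrite -pair_eqE /pair_eq /= -/(src e) srcE -/(dst e) dstE !eqxx.
  - by move=> a b; have := loopless e; rewrite a b eqxx.
  - by move=> a b; have := loopless f; rewrite -a -b eqxx.
have ends_root v : ends v != (root, root).
  case: v => [e|i] /=; rewrite xpair_eqE.
    by apply/negP => /andP[/eqP a /eqP b]; have := loopless e; rewrite a b eqxx.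
  by rewrite andbb; apply/eqP => E; have := valP i; rewrite /= E root0.
rewrite -cardsX (cardsD1 (root, root) (setX W V)).
have -> : ((root, root) \in setX W V) = (root \in V :&: W) by rewrite !inE andbC.
rewrite addnC leq_add2l.
rewrite -(card_imset _ ends_inj) subset_leq_card //.
apply/subsetP => _ /imsetP[v + ->]; rewrite !inE ends_root /=.
by case: v => [e|i] /= /andP[vB vK]; rewrite -?(clx _ vB) -?(cly _ vB) vK.
Qed.

(** Both K and its complement are unions of components, so the arc counts hold
    for both, while the integer identity comes from K, which contains w_1. *)
Lemma basis_arc_closed_full b B L U (root : 'I_n) (K : {set net_vertex n}) :
  (2 <= n)%N -> root = 0%N :> nat -> 0 < b < 1 -> 8 * n%:R ^+ 3 * (1 - b) <= 1 ->
  @feasible_basis R n G b B L U -> arc_closed (@net_arc n G @: B) K ->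
  inr root \in K -> K = [set: net_vertex n].
Proof.
move=> n2 root0 b01 b_close [basisB [x [y [bsol wh]]]] clK rootK.
pose V (K : {set net_vertex n}) := [set i | inl i \in K].
pose W (K : {set net_vertex n}) := [set i | inr i \in K].
have clx K' : arc_closed (@net_arc n G @: B) K' ->
    forall e, inl e \in B -> (src e \in W K') = (dst e \in V K').
  by move=> cl e eB; have := cl _ (imset_f _ eB); rewrite !inE.
have cly K' : arc_closed (@net_arc n G @: B) K' ->
    forall i, inr i \in B -> (val i \in V K') = (val i \in W K').
  by move=> cl i iB; have := cl _ (imset_f _ iB); rewrite !inE.
have cardK (K' : {set net_vertex n}) : #|K'| = (#|V K'| + #|W K'|)%N.
  by rewrite -!sum1_card big_sumType /=; congr (_ + _)%N; apply: eq_bigl => i; rewrite inE.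
have count K' : arc_closed (@net_arc n G @: B) K' ->
    (#|V K'| + #|W K'| + (root \in V K' :&: W K') <= #|W K'| * #|V K'|)%N.
  move=> cl; apply: leq_trans (card_arcs_within root0 (clx _ cl) (cly _ cl)).
  rewrite leq_add2r -cardK.
  rewrite -(circulation_free_card (net_circulation_free basisB) (net_card basisB) cl).
  rewrite -(card_imset _ (@net_arc_inj n G)) subset_leq_card //.
  apply/subsetP => a; rewrite inE => /andP[/imsetP[v vB ->] vK].
  by apply/imset_f; rewrite inE vB /=; case: v vB vK => [e|i] _ /=; rewrite inE.
have rootW : root \in W K by rewrite inE.
have [X [Y [u [XE cutE Y_bnd u_bnd]]]] :=
  cut_identity n2 b01 root0 basisB bsol wh (clx _ clK) (cly _ clK) rootW.
have card_le (Z : {set 'I_n}) : (#|Z| <= n)%N by rewrite -[X in (_ <= X)%N]card_ord max_card.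
have [wv uE] := cut_rounding n2 (card_le _) b01 b_close XE cutE Y_bnd u_bnd.
have countK := count _ clK; have countC := count _ (arc_closedC clK).
have VC : #|V (~: K)| = (n - #|V K|)%N.
  by rewrite [LHS]cardsCs card_ord; congr (_ - _)%N; apply: eq_card => i; rewrite !inE negbK.
have WC : #|W (~: K)| = (n - #|W K|)%N.
  by rewrite [LHS]cardsCs card_ord; congr (_ - _)%N; apply: eq_card => i; rewrite !inE negbK.
have w0 : (0 < #|W K|)%N by apply/card_gt0P; exists root.
rewrite in_setI rootW andbT wv in countK; rewrite VC WC wv in countC.
rewrite wv in uE w0.
have vn : #|V K| = n.
  apply: cut_arith countK _ uE; first by rewrite w0 card_le.
  by apply: leq_trans countC; rewrite leq_addr.
by apply/eqP; rewrite eqEcard subsetT cardsT card_sum card_ord cardK wv vn leqnn.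
Qed.

End Connectivity.

Lemma parameter_near_one (R : realFieldType) (n : nat) (alpha : R) : (0 < n)%N ->
  0 < alpha < 1 ->
  exists2 b : R, alpha <= b < 1 & 8 * n%:R ^+ 3 * (1 - b) <= 1.
Proof.
move=> n0 /andP[a0 a1]; pose M : R := 8 * n%:R ^+ 3.
have M0 : 0 < M by rewrite mulr_gt0 // exprn_gt0 // ltr0n.
exists (Num.max alpha (1 - M^-1)).
  by rewrite le_max lexx gt_max a1 /= ltrBlDr ltrDl invr_gt0.
rewrite -/M -[X in _ <= X](divff (lt0r_neq0 M0)) ler_wpM2l ?(ltW M0) //.
by rewrite lerBlDr -lerBlDl le_max lexx orbT.
Qed.

Theorem theorem3p2 (R : realType) (n : nat) (hn : (2 <= n)%N)
    (G : rel 'I_n) (G_loopless : irreflexive G)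
    (alpha : R) (alpha_in01 : 0 < alpha < 1)
    (alpha_stable : feasible_bases_stable G alpha)
    (beta : R) (beta_close : alpha <= beta < 1)
    (B' L' U' : {set net_vertex n * net_vertex n}) :
  net_feasible_basis G beta B' L' U' ->
  good_augmented_tree (net_mult G beta) B'.
Proof.
case=> B [L [U [feasB -> _ _]]].
have n0 : (0 < n)%N by apply: leq_trans hn.
have [b b_in b_close] := parameter_near_one n0 alpha_in01.
(* The same basis is feasible at a parameter b as close to 1 as needed. *)
have feasb := (alpha_stable _ _ beta_close b_in B L U).1 feasB.
have b01 : 0 < b < 1.
  by case/andP: b_in alpha_in01 => ab -> /andP[a0 _]; rewrite (lt_le_trans a0 ab).
have [basisB _] := feasB.
have beta0 : 0 < beta.
  by case/andP: beta_close alpha_in01 => ab _ /andP[a0 _]; rewrite (lt_le_trans a0 ab).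
have mult0 a : net_mult G beta a != 0.
  by rewrite /net_mult; case: ifP => _; rewrite ?oner_eq0 // lt0r_neq0.
pose root := Ordinal n0.
pose e := [rel a c | ((a, c) \in @net_arc n G @: B) || ((c, a) \in @net_arc n G @: B)].
have e_sym : connect_sym e by apply: sym_connect_sym => a c /=; rewrite orbC.
have from_root a : connect e (inr root) a.
  pose K := [set a | connect e (inr root) a].
  suff KT : K = [set: net_vertex n] by have := in_setT a; rewrite -KT inE.
  apply: (basis_arc_closed_full (root := root) G_loopless hn _ b01 b_close feasb);
    rewrite ?inE // => -[c d] cdB; rewrite !inE /=.
  by apply/idP/idP => /connect_trans; apply; apply: connect1; rewrite /= cdB ?orbT.
split; last by move=> c; apply: circulation_free_not_breakeven (net_circulation_free basisB).
apply: (@connected_augmented_tree R); last by apply/card_gt0P; exists (inr root).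
  by move=> a c; apply: connect_trans (from_root c); rewrite e_sym; apply: from_root.
exact: net_card basisB.
Qed.
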